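(* Let $\{P_n(z)\}_{n=0}^\infty$ be a monic OPS with respect to a positive-definite linear functional $\mathcal{L}$ and let $\kappa\in\mathbb{C}\setminus\mathbb{R}$. If $\{P_n(z)\}_{n=0}^\infty$ is in the Nevai class $\mathcal{N}(a,c)$ ($c\in\mathbb{R}$, $a\in[0,\infty)$), then so is the monic OPS $\{P_n^{-*}(\kappa,z)\}_{n=0}^\infty$ of a Geronimus transformation $\mathcal{L}^{-*}$ of $\mathcal{L}$ at $\kappa$, provided this OPS exists.
   Context: A linear functional $\mathcal{L}:\mathbb{C}[z]\to\mathbb{C}$ is positive-definite if $\mathcal{L}[p]>0$ for every polynomial $p$ that is not identically zero and is non-negative on $\mathbb{R}$. A monic orthogonal polynomial system (OPS) with respect to a functional $\mathcal{M}$ is a sequence of monic polynomials $p_n$ with $\deg p_n=n$, $\mathcal{M}[p_np_m]=0$ for $n\neq m$, and $\mathcal{M}[p_n^2]\neq0$ for all $n$. A monic OPS satisfies $p_0=1$, $p_1(z)=z-c_1$, $zp_n=p_{n+1}+c_{n+1}p_n+\lambda_{n+1}p_{n-1}$ for $n\ge1$, with complex $c_n$ and $\lambda_n\ne0$. It is in the Nevai class $\mathcal{N}(a,c)$ if $c_n\to c$ and $\lambda_n\to a$ (the same definition is used when $c_n,\lambda_n$ are complex). A Geronimus transformation of $\mathcal{L}$ at $\kappa$ is a linear functional $\mathcal{L}^{-*}$ with $\mathcal{L}^{-*}((z-\kappa)p(z))=\mathcal{L}(p(z))$ for all polynomials $p$; it is determined by the free parameter $s_0^*=\mathcal{L}^{-*}(1)$.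 Let $Q_n(z)=\mathcal{L}\left(\frac{P_n(z)-P_n(y)}{z-y}\right)_y$ (functional acting in $y$). The OPS of $\mathcal{L}^{-*}$ exists when $s_0^*\neq 0$ and $s_0^*P_{n-1}(\kappa)+Q_{n-1}(\kappa)\neq0$ for all $n\ge1$, and then $P_0^{-*}=1$ and $$P_n^{-*}(\kappa,z)=P_n(z)-\frac{s_0^*P_n(\kappa)+Q_n(\kappa)}{s_0^*P_{n-1}(\kappa)+Q_{n-1}(\kappa)}P_{n-1}(z),\quad n\ge1.$$ *)

(* Defs.v *)
From mathcomp Require Import all_boot all_order all_algebra.
From mathcomp Require Import complex.
From mathcomp Require Import all_classical all_reals all_analysis.

Set Implicit Arguments.
Unset Strict Implicit.
Unset Printing Implicit Defensive.

Import Order.TTheory GRing.Theory Num.Theory.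
Import numFieldNormedType.Exports.

Local Open Scope complex_scope.
Local Open Scope classical_set_scope.
Local Open Scope ring_scope.

(* The order on R[i] is partial: 0 <= z (resp. 0 < z) says that z is real and
   nonnegative (resp. positive). *)
Definition positive_definite (R : realType)
    (L : {scalar {poly R[i]}}) : Prop :=
  forall p : {poly R[i]},
    p != 0 -> (forall x : R, 0 <= p.[x%:C]) -> 0 < L p.

Definition monic_OPS (R : realType)
    (M : {scalar {poly R[i]}}) (p : nat -> {poly R[i]}) : Prop :=
  [/\ forall n : nat, p n \is monic /\ size (p n) = n.+1,
      forall n m : nat, n != m -> M (p n * p m) = 0
    & forall n : nat, M (p n ^+ 2) != 0].

(* Only c_ n for n >= 1 and lam_ n for n >= 2 occur; the other values of these
   sequences are irrelevant. *)
Definition recurrence_coefficients (R : realType)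
    (p : nat -> {poly R[i]}) (c_ lam_ : nat -> R[i]) : Prop :=
  [/\ p 0%N = 1,
      p 1%N = 'X - (c_ 1%N)%:P,
      forall n, (1 <= n)%N ->
        'X * p n = p n.+1 + c_ n.+1 *: p n + lam_ n.+1 *: p n.-1
    & forall n, (1 <= n)%N -> lam_ n.+1 != 0].

(* The recurrence determines c_ n for n >= 1 and lam_ n for n >= 2, so the
   existential quantifiers merely name the coefficients of p.  The limits are
   those of the usual topology of the complex plane; R[i]^o is R[i] seen as a
   normed space over itself. *)
Definition Nevai_class (R : realType)
    (a c : R) (p : nat -> {poly R[i]}) : Prop :=
  exists c_ lam_ : nat -> R[i],
    [/\ recurrence_coefficients p c_ lam_,
        c_ n @[n --> \oo] --> (c%:C : R[i]^o)
      & lam_ n @[n --> \oo] --> (a%:C : R[i]^o)].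

Definition Geronimus_transformation (R : realType)
    (L : {scalar {poly R[i]}}) (kappa : R[i])
    (M : {scalar {poly R[i]}}) : Prop :=
  forall p : {poly R[i]}, M (('X - kappa%:P) * p) = L p.

(* Main.v *)
Require Import Defs.
From mathcomp Require Import all_boot all_order all_algebra.
From mathcomp Require Import ring lra.
From mathcomp Require Import complex.
From mathcomp Require Import all_classical all_reals all_analysis.

(* Put [t n = Lstar (P n)]. Orthogonality forces
   [Pstar n.+1 = P n.+1 - A n *: P n] with [A n = t n.+1 / t n] and [t n != 0],
   and the three-term recurrence gives
   [t n.+2 = (kappa - c_ n.+2) * t n.+1 - lam_ n.+2 * t n]. The limiting
   characteristic equation [x ^+ 2 - (kappa - c) * x + a = 0] has roots of
   distinct moduli because [kappa] is not real, so [A] converges by Poincare's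
   theorem. Comparing coefficients, the recurrence coefficients of [Pstar] are
   [c_ n.+2 + A n.+1 - A n] and [lam_ n.+2 + A n * (c_ n.+2 + A n.+1 - A n -
   c_ n.+1)], which tend to [c] and [a] whatever the limit of [A] is. *)

Set Implicit Arguments.
Unset Strict Implicit.
Unset Printing Implicit Defensive.

Import Order.TTheory GRing.Theory Num.Theory.
Import numFieldNormedType.Exports.
Import ComplexField.Normc.

Local Open Scope complex_scope.
Local Open Scope classical_set_scope.
Local Open Scope ring_scope.

(** * Growth of weakly coupled nonnegative sequences *)

Lemma bernoulli_ge (R : realDomainType) (mu : R) (k : nat) :
  1 <= mu -> 1 + (mu - 1) * k%:R <= mu ^+ k.
Proof.
move=> mu1; elim: k => [|k IH]; first by rewrite mulr0 addr0 expr0.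
have mk1 : 1 <= mu ^+ k by rewrite exprn_ege1.
have {mk1 mu1} : 0 <= (mu - 1) * (mu ^+ k - 1) by rewrite mulr_ge0 // subr_ge0.
rewrite exprS -natr1; lra.
Qed.

(* If [x] dominates [y] by a factor [s] that is neither tiny nor huge, then one
   step later it dominates by the factor [mu * s]: the ratio [x / y] is expelled
   from every window [[B^-1, B]] and, once above it, never returns. *)
Lemma growth_step (R : realFieldType) (p q mu B eta s x y x' y' : R) :
  0 <= x -> 0 <= y -> 0 <= q -> 0 < mu -> 1 <= B -> 0 <= eta ->
  eta * ((1 + B) * (1 + mu)) <= p - mu * q ->
  B^-1 <= s <= B ->
  p * x - eta * (x + y) <= x' -> y' <= q * y + eta * (x + y) ->
  s * y <= x -> mu * s * y' <= x'.
Proof.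
move=> x0 y0 q0 mu0 B1 eta0 eta_le /andP[sB Bs] hx' hy' syx.
have B0 : 0 < B by lra.
have s0 : 0 < s by apply: lt_le_trans sB; rewrite invr_gt0.
have yBx : y <= B * x.
  apply: le_trans (ler_wpM2l (ltW B0) syx).
  by rewrite mulrA ler_peMl // -ler_pdivrMl // mulr1.
have sxBx : s * x <= B * x by rewrite ler_wpM2r.
(* The error terms are bounded by multiples of [x], in total [eta * ((1 + B) * (1 + mu)) * x], which
   [eta_le] absorbs. *)
have h1 : mu * s * y' <= mu * s * (q * y + eta * (x + y)).
  by rewrite ler_wpM2l // mulr_ge0 // ltW.
have h2 : mu * q * (s * y) <= mu * q * x.
  by rewrite ler_wpM2l // mulr_ge0 // ltW.
have h3 : mu * eta * (s * x + s * y) <= mu * eta * (B * x + x).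
  by rewrite ler_wpM2l ?lerD // mulr_ge0 // ltW.
have h4 : eta * (x + y) <= eta * (x + B * x) by rewrite ler_wpM2l // lerD.
have h5 := ler_wpM2r x0 eta_le.
by apply: le_trans hx'; apply: le_trans h1 _; lra.
Qed.

(** Fix [B >= 1]. Once the errors are small, a late ratio [x / y] that reaches [B^-1] is driven
    above [B] by [growth_step] and stays there; if none reaches it, [y] dominates. One [B] at which
    the first alternative fails forces the second for all [B]. *)
Lemma growth_dichotomy (R : realType) (x y : nat -> R) (p q : R) :
  (forall n, 0 <= x n) -> (forall n, 0 <= y n) -> 0 <= q -> q < p ->
  (forall e, 0 < e -> \forall n \near \oo,
     p * x n - e * (x n + y n) <= x n.+1 /\
     y n.+1 <= q * y n + e * (x n + y n)) ->
  (forall B, \forall n \near \oo, B * y n <= x n) \/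
  (forall B, \forall n \near \oo, B * x n <= y n).
Proof.
move=> x0 y0 q0 qp step.
have window B : 1 <= B -> (\forall n \near \oo, B * y n <= x n) \/
                          (\forall n \near \oo, B * x n <= y n).
  move=> B1; have B0 : 0 < B by lra.
  (* Chosen so that [1 < mu] and [mu * q < p], also when [q = 0]. *)
  pose mu := 2 * p / (p + q).
  have mu1 : 1 < mu by rewrite /mu ltr_pdivlMr; lra.
  have muq : 0 < p - mu * q.
    rewrite (_ : _ - _ = p * (p - q) / (p + q)); last by rewrite /mu; field; lra.
    by rewrite divr_gt0 ?mulr_gt0; lra.
  have D0 : 0 < (1 + B) * (1 + mu) by rewrite mulr_gt0; lra.
  pose eta := (p - mu * q) / ((1 + B) * (1 + mu)).
  have eta0 : 0 < eta by rewrite divr_gt0.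
  have [N _ stepN] := step _ eta0.
  have up n s : (N <= n)%N -> B^-1 <= s <= B ->
      s * y n <= x n -> mu * s * y n.+1 <= x n.+1.
    move=> Nn sB; have [hx hy] := stepN _ Nn.
    apply: (growth_step (p := p) (q := q) (B := B) (eta := eta)) hx hy => //.
    - by lra.
    - exact: ltW.
    - by rewrite /eta divfK ?gt_eqF.
  have [[n Nn yBx]|none] := pselect (exists2 n, (N <= n)%N & y n <= B * x n).
    (* The cap [B] keeps [s j] in the window, so [growth_step] can be iterated forever. *)
    left; pose s j := Num.min (mu ^+ j / B) B.
    have sB j : B^-1 <= s j <= B.
      rewrite /s ge_min lexx orbT andbT le_min; apply/andP; split.
        by rewrite ler_peMl ?invr_ge0 ?(ltW B0) // exprn_ege1 // ltW.
      by rewrite (le_trans _ B1) // invf_le1.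
    have climb j : s j * y (n + j)%N <= x (n + j)%N.
      elim: j => [|j IH].
        rewrite addn0 /s expr0 (@le_trans _ _ (B^-1 * y n)) //.
          by rewrite ler_wpM2r // ge_min mul1r lexx.
        by rewrite mulrC ler_pdivrMr // mulrC.
      rewrite addnS; apply: le_trans (up _ _ _ (sB j) IH); last first.
        exact: leq_trans Nn (leq_addr _ _).
      rewrite ler_wpM2r // /s minr_pMr ?(le_trans _ (ltW mu1)) //.
      rewrite exprS mulrA le_min !ge_min lexx /=.
      by rewrite (_ : B <= mu * B) ?orbT // ler_peMl // ltW.
    have [k hk] : exists k, B ^+ 2 <= mu ^+ k.
      exists (Num.bound (B ^+ 2 / (mu - 1))).
      apply: le_trans (bernoulli_ge _ (ltW mu1)).
      have := archi_boundP (_ : 0 <= B ^+ 2 / (mu - 1)).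
      rewrite divr_ge0 ?sqr_ge0 ?subr_ge0 ?(ltW mu1) // => /(_ isT).
      by rewrite ltr_pdivrMr ?subr_gt0 // mulrC; lra.
    exists (n + k)%N => // m /= nkm.
    have [j jm] : exists j, m = (n + (k + j))%N.
      by exists (m - (n + k))%N; rewrite addnA subnKC.
    have -> : B = s (k + j)%N.
      rewrite /s min_r // ler_pdivlMr // -expr2 (le_trans hk) //.
      by rewrite exprD ler_peMr ?exprn_ge0 ?exprn_ege1 //; lra.
    by rewrite jm; apply: climb.
  right; exists N => // n /= Nn; rewrite leNgt; apply/negP => /ltW yBx.
  by apply: none; exists n.
have [all1|] := pselect (forall B, 1 <= B -> \forall n \near \oo, B * y n <= x n).
  left=> B; have [B1|/ltW B1] := leP 1 B; first exact: all1.
  have [N _ hN] := all1 1 (lexx _); exists N => // n /hN; rewrite mul1r.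
  by apply: le_trans; rewrite ler_piMl.
move=> /existsNP[B0 /not_implyP[B01 fails]]; right=> B.
(* Dominance of [x] at level [C >= B0] would give it at [B0], where it fails. *)
pose C := Num.max B B0.
have C1 : 1 <= C by rewrite le_max B01 orbT.
have [[N _ hN]|[N _ hN]] := window C C1.
  exfalso; apply: fails; exists N => // n /hN; apply: le_trans.
  by rewrite ler_wpM2r // le_max lexx orbT.
by exists N => // n /hN; apply: le_trans; rewrite ler_wpM2r // le_max lexx.
Qed.

(** * Complex limits through real moduli *)

(** Positive elements of [R[i]] are real, so complex and real radii are interchangeable. *)
Lemma cvgn_normcP (R : realType) (f : nat -> R[i]) (l : R[i]) :
  (f n @[n --> \oo] --> (l : R[i]^o)) <->
  (forall e : R, 0 < e -> \forall n \near \oo, normc (f n - l) <= e).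
Proof.
apply: (iff_trans (@cvgrPdistC_le _ R[i]^o _ _ _ f l)); split=> [fl e e0|fl e e0].
  have /fl[N _ hN] : 0 < e%:C by rewrite ltcR.
  by exists N => // n /hN /=; rewrite -lecR.
have eR : (complex.Re e)%:C = e by rewrite RRe_real // gtr0_real.
have /fl[N _ hN] : 0 < complex.Re e by rewrite -ltcR eR.
by exists N => // n /hN /=; rewrite -lecR eR.
Qed.

Lemma cvgn_shiftS (R : realType) (f : nat -> R[i]) (l : R[i]) :
  (f n.+1 @[n --> \oo] --> (l : R[i]^o)) <-> (f n @[n --> \oo] --> (l : R[i]^o)).
Proof.
split=> /cvgn_normcP fl; apply/cvgn_normcP => e /fl[N _ hN].
  by exists N.+1 => // -[//|n]; exact: hN.
by exists N => // n Nn; apply: hN; exact: leqW.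
Qed.

(* [R[i]] has no canonical topology; limits are taken in [R[i]^o]. *)
Lemma cvgn_complex_sub (R : realType) (f g : nat -> R[i]) (l m : R[i]) :
  f n @[n --> \oo] --> (l : R[i]^o) -> g n @[n --> \oo] --> (m : R[i]^o) ->
  f n - g n @[n --> \oo] --> (l - m : R[i]^o).
Proof. exact: (@cvgB R[i] R[i]^o). Qed.

Lemma cvgn_complex_add (R : realType) (f g : nat -> R[i]) (l m : R[i]) :
  f n @[n --> \oo] --> (l : R[i]^o) -> g n @[n --> \oo] --> (m : R[i]^o) ->
  f n + g n @[n --> \oo] --> (l + m : R[i]^o).
Proof. exact: (@cvgD R[i] R[i]^o). Qed.

Lemma cvgn_complex_mul (R : realType) (f g : nat -> R[i]) (l m : R[i]) :
  f n @[n --> \oo] --> (l : R[i]^o) -> g n @[n --> \oo] --> (m : R[i]^o) ->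
  f n * g n @[n --> \oo] --> (l * m : R[i]^o).
Proof. exact: (@cvgM R[i]). Qed.

Lemma normc_ge0 (R : rcfType) (z : R[i]) : 0 <= normc z.
Proof. by rewrite -lecR; exact: (@normr_ge0 _ R[i]). Qed.

Lemma normc_gt0 (R : rcfType) (z : R[i]) : (0 < normc z) = (z != 0).
Proof. by rewrite -ltcR; exact: (@normr_gt0 _ R[i]). Qed.

Lemma le_normcB (R : rcfType) (z w : R[i]) :
  normc (z - w) <= normc z + normc w.
Proof. by rewrite -lecR rmorphD; exact: (@ler_normB _ R[i]). Qed.

Lemma ge_normcD (R : rcfType) (z w : R[i]) :
  normc z - normc w <= normc (z + w).
Proof. by rewrite -lecR rmorphB; exact: (@lerB_normD _ R[i]). Qed.

Lemma ge_normcB (R : rcfType) (z w : R[i]) :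
  normc z - normc w <= normc (z - w).
Proof. by rewrite -lecR rmorphB; exact: (@lerB_dist _ R[i]). Qed.

(** * Poincare's theorem for second-order recurrences *)

(* [x] and [y] are the moduli of the two components of a solution [T], whose
   ratio [f] deviates from [l] through the component [y] only. *)
Lemma dominant_cvg (R : realType) (f : nat -> R[i]) (l : R[i])
    (T : nat -> R[i]) (D : R) (x y : nat -> R) :
  0 < D -> (forall n, T n != 0) ->
  (forall n, x n - y n <= D * normc (T n)) ->
  (forall n, normc ((f n - l) * T n) <= y n) ->
  (forall B, \forall n \near \oo, B * y n <= x n) ->
  f n @[n --> \oo] --> (l : R[i]^o).
Proof.
move=> D0 T0 xyT fy dom; apply/cvgn_normcP => e e0.
(* With this factor [y + D / e * y <= x <= D * normc (T n) + y], hence [y <= e * normc (T n)]. *)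
have [N _ hN] := dom (1 + D / e); exists N => // n /hN h.
have Tn : 0 < normc (T n) by rewrite normc_gt0.
rewrite -(ler_pM2r Tn) -normcM; apply: le_trans (fy n) _.
have := le_trans h (_ : x n <= D * normc (T n) + y n).
rewrite -lerBlDr => /(_ (xyT n)).
rewrite mulrDl mul1r addrC lerD2r mulrAC ler_pdivrMr // -mulrA ler_pM2l //.
by rewrite mulrC [e * _]mulrC.
Qed.

(** The components [u] and [v] are multiplied by [x1] and [x2] up to a common small error, so one of
    them dominates. As [v n = (t n.+1 / t n - x1) * t n], and likewise for [u] and [x2], the ratio
    tends to [x1] if [u] dominates and to [x2] if [v] does. *)
Lemma Poincare_ratio (R : realType) (al be t : nat -> R[i]) (x1 x2 : R[i]) :
  `|x2| < `|x1| ->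
  al n @[n --> \oo] --> (x1 + x2 : R[i]^o) ->
  be n @[n --> \oo] --> (x1 * x2 : R[i]^o) ->
  (forall n, t n != 0) ->
  (forall n, t n.+2 = al n * t n.+1 - be n * t n) ->
  exists l : R[i], (t n.+1 / t n) @[n --> \oo] --> (l : R[i]^o).
Proof.
move=> x21 /cvgn_normcP al_cvg /cvgn_normcP be_cvg t0 rec.
have {}x21 : normc x2 < normc x1 by rewrite -ltcR.
pose p := normc x1; pose q := normc x2; pose D := normc (x1 - x2).
have q0 : 0 <= q by exact: normc_ge0.
have p0 : 0 <= p by exact: normc_ge0.
have D0 : 0 < D.
  rewrite normc_gt0 subr_eq0; apply: contraTneq x21 => ->.
  by rewrite ltxx.
pose u n := t n.+1 - x2 * t n; pose v n := t n.+1 - x1 * t n.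
pose x n := normc (u n); pose y n := normc (v n).
have x0 n : 0 <= x n by exact: normc_ge0.
have y0 n : 0 <= y n by exact: normc_ge0.
have DT n : D * normc (t n) = normc (u n - v n).
  by rewrite -normcM /u /v; congr normc; ring.
have DT1 n : D * normc (t n.+1) <= p * (x n + y n).
  rewrite -normcM (_ : _ * _ = x1 * u n - x2 * v n); last by rewrite /u /v; ring.
  apply: le_trans (le_normcB _ _) _; rewrite !normcM mulrDr lerD2l.
  exact: ler_wpM2r (y0 n) _ _ (ltW x21).
have perturb e : 0 < e -> \forall n \near \oo,
    normc ((al n - (x1 + x2)) * t n.+1 - (be n - x1 * x2) * t n)
      <= e * (x n + y n).
  (* [D * normc (t n)] is at most [x n + y n] and [D * normc (t n.+1)] at most [p] times that; hence
     the divisor [p + 1]. *)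
  move=> e0; pose d := e * D / (p + 1).
  have d0 : 0 < d by rewrite divr_gt0 ?mulr_gt0 //; lra.
  have [N1 _ h1] := al_cvg d d0; have [N2 _ h2] := be_cvg d d0.
  exists (maxn N1 N2) => // n; rewrite /= geq_max => /andP[n1 n2].
  apply: le_trans (le_normcB _ _) _; rewrite !normcM.
  apply: le_trans (lerD (ler_wpM2r (normc_ge0 _) (h1 _ n1))
                        (ler_wpM2r (normc_ge0 _) (h2 _ n2))) _.
  have -> : d * normc (t n.+1) + d * normc (t n) =
      e / (p + 1) * (D * normc (t n.+1) + D * normc (t n)).
    by rewrite /d; field; lra.
  rewrite [D * normc (t n)]DT.
  have -> : e * (x n + y n) = e / (p + 1) * (p * (x n + y n) + (x n + y n)).
    by field; lra.
  rewrite ler_wpM2l ?(lerD (DT1 n)) ?le_normcB //.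
  by rewrite divr_ge0; lra.
have step e : 0 < e -> \forall n \near \oo,
    p * x n - e * (x n + y n) <= x n.+1 /\
    y n.+1 <= q * y n + e * (x n + y n).
  move=> /perturb[N _ hN]; exists N => // n /hN h; split.
    rewrite /x [u n.+1](_ : _ = x1 * u n +
      ((al n - (x1 + x2)) * t n.+1 - (be n - x1 * x2) * t n)); last first.
      by rewrite /u rec; ring.
    apply: le_trans (ge_normcD _ _); rewrite normcM -/p -/(x n).
    by rewrite lerD2l lerN2.
  rewrite {1}/y [v n.+1](_ : _ = x2 * v n +
    ((al n - (x1 + x2)) * t n.+1 - (be n - x1 * x2) * t n)); last first.
    by rewrite /v rec; ring.
  by apply: le_trans (le_normcD _ _) _; rewrite normcM lerD2l.
have [dom|dom] := growth_dichotomy x0 y0 q0 x21 step.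
  exists x1; apply: (dominant_cvg D0 t0 _ _ dom) => n.
    by rewrite DT ge_normcB.
  by rewrite mulrBl divfK.
exists x2; apply: (dominant_cvg D0 t0 _ _ dom) => n.
  by rewrite DT -normcN opprB ge_normcB.
by rewrite mulrBl divfK.
Qed.

(* The roots have product [a >= 0]; if they had equal moduli they would be
   complex conjugate, and their sum would be real. *)
Lemma nonreal_sum_roots (R : realType) (s : R[i]) (a : R) :
  s \isn't Num.real -> 0 <= a ->
  exists x1 x2 : R[i], [/\ `|x2| < `|x1|, x1 + x2 = s & x1 * x2 = a%:C].
Proof.
move=> s_nr a0.
(* The encoded equation is [x ^+ 2 = s * x - a]. *)
have [x1 hx1] := @solve_monicpoly R[i] 2 (fun i => if i == 0%N then - a%:C else s)
  isT.
move: hx1; rewrite big_ord_recl big_ord1 /= expr0 mulr1 expr1 => hx1.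
pose x2 := s - x1.
have prod : x1 * x2 = a%:C by rewrite /x2 mulrBr -expr2 hx1; ring.
have sum : x1 + x2 = s by rewrite /x2; ring.
have neq : `|x1| != `|x2|.
  apply: contra s_nr => /eqP eqn; rewrite -sum.
  (* The product [a >= 0] is its own modulus, which is the squared modulus of [x1]; cancelling [x1]
     makes [x2] its conjugate. *)
  have : x1 * x2 = x1 * x1^*%C.
    rewrite -sqr_normc expr2 [in X in _ = _ * X]eqn -normrM prod.
    by rewrite ger0_norm // lecR.
  have [x10 _|x10 /(mulfI x10) ->] := eqVneq x1 0.
    have : `|x2| = 0 by rewrite -eqn x10 normr0.
    by rewrite x10 => /normr0_eq0 ->; rewrite addr0 real0.
  by case: x1 {hx1 x2 prod sum eqn x10} => r i; rewrite [_ + _]/= complex_real subrr.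
have [lt|lt|eq] := real_ltgtP (normr_real x1) (normr_real x2).
- by exists x2, x1; rewrite addrC mulrC.
- by exists x1, x2.
- by rewrite eq eqxx in neq.
Qed.

(** * Expansion in a monic orthogonal system *)

Lemma size_subr_lead (K : nzRingType) (p q : {poly K}) (n : nat) :
  (size p <= n.+1)%N -> (size q <= n.+1)%N -> p`_n = q`_n ->
  (size (p - q)%R <= n)%N.
Proof.
move=> sp sq pq; apply/leq_sizeP => j; rewrite leq_eqVlt => /predU1P[<-|nj].
  by rewrite coefB pq subrr.
by rewrite coefB !nth_default ?subrr // (leq_trans _ nj).
Qed.

Section OrthogonalPolynomials.

Variables (R : realType) (M : {scalar {poly R[i]}}) (p : nat -> {poly R[i]}).
Hypothesis hp : monic_OPS M p.

Lemma OPS_size n : size (p n) = n.+1.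
Proof. by case: hp => /(_ n)[]. Qed.

Lemma OPS_coef n : (p n)`_n = 1.
Proof.
have [/(_ n)[/monicP mon _] _ _] := hp.
by rewrite -[RHS]mon lead_coefE OPS_size.
Qed.

Lemma OPS_0 : p 0%N = 1.
Proof.
by rewrite [p 0%N]size1_polyC ?OPS_size // OPS_coef.
Qed.

Lemma OPS_reduce (q : {poly R[i]}) m : (size q <= m.+1)%N ->
  (size (q - q`_m *: p m)%R <= m)%N.
Proof.
move=> sq; apply: size_subr_lead; rewrite // ?coefZ ?OPS_coef ?mulr1 //.
by rewrite (leq_trans (size_scale_leq _ _)) // OPS_size.
Qed.

Lemma OPS_orthogonal n (q : {poly R[i]}) : (size q <= n)%N -> M (p n * q) = 0.
Proof.
have [_ orth _] := hp.
suff H m : (m <= n)%N ->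
    forall q : {poly R[i]}, (size q <= m)%N -> M (p n * q) = 0.
  exact: H.
elim: m => [_ r|m IH mn r sr].
  by rewrite leqn0 size_poly_eq0 => /eqP->; rewrite mulr0 linear0.
rewrite -[r](subrK (r`_m *: p m)) mulrDr linearD /= IH ?OPS_reduce ?(ltnW mn) //.
by rewrite add0r -scalerAr linearZ /= orth ?mulr0 // gtn_eqF.
Qed.

(** Pairing with [p n] isolates the top coefficient times the nonzero [M (p n ^+ 2)], so the size
    bound drops by one. *)
Lemma OPS_eq0 n (q : {poly R[i]}) : (size q <= n)%N ->
  (forall m, (m < n)%N -> M (p m * q) = 0) -> q = 0.
Proof.
have [_ _ nz] := hp.
elim: n => [|n IH] sq orth; first by move: sq; rewrite leqn0 size_poly_eq0 => /eqP.
have qn0 : q`_n = 0.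
  have := orth n (ltnSn n).
  rewrite -{1}[q](subrK (q`_n *: p n)) mulrDr linearD /=.
  rewrite OPS_orthogonal ?OPS_reduce // add0r -scalerAr linearZ /= -expr2.
  by move/eqP; rewrite mulf_eq0 (negbTE (nz n)) orbF => /eqP.
apply: IH => [|m mn]; last by apply: orth; exact: ltnW.
by have := OPS_reduce sq; rewrite qn0 scale0r subr0.
Qed.

Lemma OPS_eqZ n (q : {poly R[i]}) : (size q <= n.+1)%N ->
  (forall m, (m < n)%N -> M (p m * q) = 0) -> q = q`_n *: p n.
Proof.
have [_ orth _] := hp.
move=> sq qorth; apply/eqP; rewrite -subr_eq0; apply/eqP.
apply: (OPS_eq0 (OPS_reduce sq)) => m mn.
by rewrite mulrBr linearB /= qorth // -scalerAr linearZ /= orth ?ltn_eqF // mulr0 subr0.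
Qed.

End OrthogonalPolynomials.

(** * The Geronimus polynomials *)

(** For [q = Ps n.+1 - P n.+1], [L (P m * q)] is zero when [m < n] and equals [Ls (Ps n.+1 ^+ 2)]
    when [m = n]; so [q = b *: P n] with [b != 0]. Applying [Ls] to [Ps n.+1] then yields [b]. The
    number [Ls (P n)] is the classical [s_0^* P_n(kappa) + Q_n(kappa)]. *)
Lemma Geronimus_OPS (R : realType) (L Ls : {scalar {poly R[i]}})
    (P Ps : nat -> {poly R[i]}) (kappa : R[i]) :
  monic_OPS L P -> monic_OPS Ls Ps -> Geronimus_transformation L kappa Ls ->
  forall n, Ls (P n) != 0 /\
            Ps n.+1 = P n.+1 - (Ls (P n.+1) / Ls (P n)) *: P n.
Proof.
move=> hP hPs hG.
have [_ Porth Pnz] := hP; have [_ _ Psnz] := hPs.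
have sX (q : {poly R[i]}) m : (size q <= m)%N ->
    (size (('X - kappa%:P) * q)%R <= m.+1)%N.
  move=> sq; apply: leq_trans (size_polyMleq _ _) _.
  by rewrite size_XsubC addSn add1n.
have step n : exists2 b, b != 0 & Ps n.+1 = P n.+1 + b *: P n.
  pose q := Ps n.+1 - P n.+1.
  have sq : (size q <= n.+1)%N.
    by apply: size_subr_lead; rewrite ?(OPS_size hP) ?(OPS_size hPs)
      ?(OPS_coef hP) ?(OPS_coef hPs).
  have Lq m : (m <= n)%N ->
      L (P m * q) = Ls (Ps n.+1 * (('X - kappa%:P) * P m)).
    move=> mn; rewrite mulrBr linearB /= Porth ?ltn_eqF // subr0 -hG.
    by congr (Ls _); ring.
  have qE : q = q`_n *: P n.
    apply: (OPS_eqZ hP) => // m mn; rewrite Lq ?(ltnW mn) //.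
    by rewrite (OPS_orthogonal hPs) // (leq_trans (sX _ m.+1 _)) ?(OPS_size hP).
  exists q`_n; last by rewrite -qE /q addrC subrK.
  apply: contraNneq (Psnz n.+1) => qn0.
  have : L (P n * q) = 0 by rewrite qE qn0 scale0r mulr0 linear0.
  rewrite Lq // -[_ * P n](subrK (Ps n.+1)) mulrDr linearD /=.
  rewrite (OPS_orthogonal hPs) ?add0r ?expr2; first by move->.
  apply: size_subr_lead; rewrite ?sX ?(OPS_size hP) ?(OPS_size hPs) //.
  rewrite (OPS_coef hPs) mulrBl coefB coefXM /= coefCM (OPS_coef hP).
  by rewrite [(P n)`_n.+1]nth_default ?(OPS_size hP) // mulr0 subr0.
have tS n b : Ps n.+1 = P n.+1 + b *: P n -> Ls (P n.+1) = - b * Ls (P n).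
  move=> PsE; have : Ls (Ps n.+1 * 1) = 0.
    by rewrite (OPS_orthogonal hPs) // size_poly1.
  by rewrite mulr1 PsE linearD linearZ /= mulNr => /eqP; rewrite addr_eq0 => /eqP.
have t0 n : Ls (P n) != 0.
  elim: n => [|n IH].
    by have := Psnz 0%N; rewrite (OPS_0 hPs) expr1n (OPS_0 hP).
  by have [b b0 /tS->] := step n; rewrite mulf_neq0 // oppr_eq0.
move=> n; split=> //; have [b b0 PsE] := step n.
by rewrite (tS _ _ PsE) mulfK // scaleNr opprK.
Qed.

(** * Recurrence coefficients of the transformed system *)

(** The hypotheses on [l] and [l * am] match the coefficients of [P0] and [Pm]; that of [P1] agrees
    identically. *)
Lemma recurrence_combination (K : comNzRingType)
    (X Pm P0 P1 P2 am a0 a1 c1 c2 l1 l2 l : K) :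
  X * P1 = P2 + c2 * P1 + l2 * P0 -> X * P0 = P1 + c1 * P0 + l1 * Pm ->
  l = l2 + a0 * (c2 + a1 - a0 - c1) -> l * am = l1 * a0 ->
  X * (P1 - a0 * P0) =
    (P2 - a1 * P1) + (c2 + a1 - a0) * (P1 - a0 * P0) + l * (P0 - am * Pm).
Proof.
move=> h1 h2 hl lam; rewrite mulrBr h1 mulrCA h2 (mulrBr l) (mulrA l) lam hl.
by ring.
Qed.

Theorem proposition4p4 (R : realType)
  (L : {scalar {poly R[i]}}) (P : nat -> {poly R[i]})
  (kappa : R[i]) (a c : R)
  (hL : positive_definite L) (hP : monic_OPS L P)
  (hkappa : kappa \isn't Num.real)
  (ha : 0 <= a) (hN : Nevai_class a c P)
  (Lstar : {scalar {poly R[i]}})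
  (hG : Geronimus_transformation L kappa Lstar)
  (Pstar : nat -> {poly R[i]}) (hPstar : monic_OPS Lstar Pstar) :
  Nevai_class a c Pstar.
Proof.
have [c_ [lam_ [[P0 P1 Prec lam0] c_cvg lam_cvg]]] := hN.
have PsE := Geronimus_OPS hP hPstar hG.
pose t n := Lstar (P n).
have t0 n : t n != 0 by case: (PsE n).
have {}PsE n : Pstar n.+1 = P n.+1 - (t n.+1 / t n) *: P n by case: (PsE n).
have LX q : Lstar ('X * q) = kappa * Lstar q + L q.
  by rewrite -hG mulrBl linearB /= mul_polyC linearZ /= addrC subrK.
have trec n : t n.+2 = (kappa - c_ n.+2) * t n.+1 - lam_ n.+2 * t n.
  have LP0 : L (P n.+1) = 0.
    by rewrite -[P _]mulr1 (OPS_orthogonal hP) // size_poly1.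
  have e : kappa * t n.+1 = t n.+2 + c_ n.+2 * t n.+1 + lam_ n.+2 * t n.
    by rewrite -[LHS]addr0 -LP0 -LX Prec // !linearD !linearZ.
  by rewrite mulrBl e; ring.
pose A n := t n.+1 / t n.
have A0 n : A n != 0 by rewrite mulf_neq0 ?invr_eq0.
have Arec n : A n.+1 = kappa - c_ n.+2 - lam_ n.+2 / A n.
  by rewrite /A trec; field; rewrite !t0.
have c1_cvg : c_ n.+1 @[n --> \oo] --> (c%:C : R[i]^o) by apply/cvgn_shiftS.
have c2_cvg : c_ n.+2 @[n --> \oo] --> (c%:C : R[i]^o).
  exact/(cvgn_shiftS (fun n => c_ n.+1)).
have lam2_cvg : lam_ n.+2 @[n --> \oo] --> (a%:C : R[i]^o).
  exact/(cvgn_shiftS (fun n => lam_ n.+1))/cvgn_shiftS.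
have [l A_cvg] : exists l : R[i], A n @[n --> \oo] --> (l : R[i]^o).
  have s_nr : kappa - c%:C \isn't Num.real.
    apply: contra hkappa => h; rewrite -(subrK c%:C kappa) rpredD //.
    by apply/complex_realP; exists c.
  have [x1 [x2 [x21 xs xp]]] := nonreal_sum_roots s_nr ha.
  have al_cvg : kappa - c_ n.+2 @[n --> \oo] --> (x1 + x2 : R[i]^o).
    rewrite xs; apply: (cvgn_complex_sub (f := fun=> kappa) _ c2_cvg).
    exact: (@cvg_cst R[i]^o).
  have be_cvg : lam_ n.+2 @[n --> \oo] --> (x1 * x2 : R[i]^o) by rewrite xp.
  exact: Poincare_ratio x21 al_cvg be_cvg t0 trec.
have A1_cvg : A n.+1 @[n --> \oo] --> (l : R[i]^o) by apply/cvgn_shiftS.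
(* [cs 1] is [c_ 1 + A 0], the missing predecessor of [A 0] counting as zero; [cs 0], [ls 0] and
   [ls 1] are dummies. *)
pose cs n := if n is m.+1 then
  c_ n + A m - (if m is k.+1 then A k else 0) else 0.
pose ls n := if n is m.+2 then
  lam_ n + A m * (c_ n + A m.+1 - A m - c_ m.+1) else 0.
have lsE n : ls n.+2 = A n * (kappa - c_ n.+1 - A n).
  by rewrite /ls Arec; field; rewrite A0.
(* This cancels the lowest term in [recurrence_combination] and also shows [ls n.+3 != 0]. *)
have lsA n : ls n.+3 * A n = lam_ n.+2 * A n.+1.
  by rewrite lsE {2}Arec; field; rewrite A0.
have cs_cvg : c_ n.+2 + A n.+1 - A n @[n --> \oo] --> (c%:C : R[i]^o).
  rewrite -[c%:C](addrK l).
  exact: (cvgn_complex_sub (cvgn_complex_add c2_cvg A1_cvg) A_cvg).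
exists cs, ls; split; first split.
- exact: OPS_0 hPstar.
- by rewrite PsE P0 P1 alg_polyC -addrA -opprD -polyCD /cs subr0.
- case=> [//|n] _; rewrite PsE [n.+1.-1]/=.
  rewrite -!mul_polyC.
  have rec m : 'X * P m.+1 = P m.+2 + (c_ m.+2)%:P * P m.+1 + (lam_ m.+2)%:P * P m.
    by rewrite !mul_polyC Prec.
  have lsP : (ls n.+2)%:P = (lam_ n.+2)%:P +
      (A n)%:P * ((c_ n.+2)%:P + (A n.+1)%:P - (A n)%:P - (c_ n.+1)%:P).
    by rewrite -!polyCD -!polyCN -!polyCD -polyCM -polyCD.
  have -> : (cs n.+2)%:P = (c_ n.+2)%:P + (A n.+1)%:P - (A n)%:P.
    by rewrite -polyCN -!polyCD.
  rewrite PsE -mul_polyC; case: n lsP => [|n] lsP.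
    (* At the bottom the predecessor of [P 0] and its coefficients are taken to be zero. *)
    have -> : Pstar 0%N = P 0%N - 0 * 0.
      by rewrite P0 mul0r subr0 (OPS_0 hPstar).
    apply: (recurrence_combination (l1 := 0) (rec 0%N) _ lsP); last by rewrite mulr0 mul0r.
    by rewrite P0 P1 !mulr1 mulr0 addr0 subrK.
  rewrite PsE -mul_polyC.
  by apply: (recurrence_combination (rec _) (rec _) lsP); rewrite -!polyCM lsA.
- case=> [//|[|n]] _; last first.
    have : lam_ n.+2 * A n.+1 != 0 by rewrite mulf_neq0 ?lam0.
    by rewrite -lsA mulf_eq0 => /norP[].
  (* For [ls 2], the second factor times [- t 0] is [L 1], which is nonzero. *)
  rewrite lsE mulf_neq0 //.
  have L1 : L 1 != 0 by case: hP => _ _ /(_ 0%N); rewrite P0 expr1n.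
  apply: contraNneq L1 => h.
  have := LX 1; rewrite mulr1 -P0 -/(t 0%N).
  have -> : 'X = P 1%N + c_ 1%N *: P 0%N by rewrite P1 P0 alg_polyC subrK.
  rewrite linearD linearZ /= -/(t 0%N) -/(t 1%N) => e.
  have -> : L (P 0%N) = - (kappa - c_ 1%N - A 0%N) * t 0%N.
    by rewrite -[LHS](addKr (kappa * t 0%N)) -e /A; field; rewrite t0.
  by rewrite h oppr0 mul0r.
- apply/(cvgn_shiftS cs)/(cvgn_shiftS (fun n => cs n.+1)); exact: cs_cvg.
- apply/(cvgn_shiftS ls)/(cvgn_shiftS (fun n => ls n.+1)).
  (* The correction to [lam_] tends to [l * (c - c)]. *)
  rewrite -[a%:C]addr0 -(mulr0 l) -(subrr c%:C).
  apply: (cvgn_complex_add lam2_cvg); apply: (cvgn_complex_mul A_cvg).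
  exact: cvgn_complex_sub cs_cvg c1_cvg.
Qed.
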